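(* Let $M$ be a matroid with ground set $E$ and a cycle system $\mathcal{C}=\{C_1,\dots,C_g\}$, where $g=g(M)$. 1. There is an explicit bijection between the set of bases of $M$ and the set $P^*(\mathcal{C})$ of coparking functions defined by $\mathcal{C}$. Precisely, fix any linear ordering of $E$. The following two procedures are well defined and terminate, and they define mutually inverse bijections between the set of bases of $M$ and $P^*(\mathcal{C})$. (Basis to coparking.) Input a basis $B$ of $M$. Set $\sigma=[g]$ and $a=(0,\dots,0)\in\mathbb{N}^g$. While $\sigma\ne\emptyset$: let $e$ be the maximal element of the unique union $\mathcal{C}_\sigma$ of the current sets $C_j$, $j\in\sigma$, and let $i$ be the unique index in $\sigma$ with $e\in C_i$; if $e\notin B$, replace $\sigma$ by $\sigma\setminus\{i\}$; if $e\in B$, replace $a_i$ by $a_i+1$ and replace $C_i$ by $C_i\setminus\{e\}$. Output $a$. (Coparking to basis.) Input $a\in P^*(\mathcal{C})$. Set $\sigma=[g]$ and $B=E$. While $\sigma\neq\emptyset$: let $e$ be the maximal element of the unique union $\mathcal{C}_\sigma$ of the current sets $C_j$, $j\in\sigma$, and let $i$ be the unique index in $\sigma$ with $e\in C_i$; replace $a_i$ by $a_i-1$; if now $a_i<0$, replace $\sigma$ by $\sigma\setminus\{i\}$ and $B$ by $B\setminus\{e\}$; otherwise replace $C_i$ by $C_i\setminus\{e\}$. Output $B$. 2. Stanley's conjecture holds for $M$: the $h$-vector of $M$ is a pure O-sequence.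
   Context: Matroids are on finite ground sets; $r(M)$ is the rank and $g(M)=|E(M)|-r(M)$ the corank. $\mathbb{N}$ includes $0$, and $\mathbb{N}^0=\{()\}$. A *cycle* of $M$ is a union of circuits of $M$. Unique union: for a family $\mathcal{A}=\{A_1,\dots,A_g\}$ of subsets of a set and $\sigma\subseteq[g]=\{1,\dots,g\}$, $\mathcal{A}_\sigma$ is the set of elements $e\in\bigcup_{i\in\sigma}A_i$ for which there is exactly one $i\in\sigma$ with $e\in A_i$. A *cycle system* for $M$ is a collection $\mathcal{C}=\{C_1,\dots,C_g\}$ of cycles of $M$ with $g=g(M)$ such that for every nonempty $\sigma\subseteq[g]$ the unique union $\mathcal{C}_\sigma$ is dependent in $M$. A *coparking function* with respect to $\mathcal{C}$ is a vector $a=(a_1,\dots,a_g)\in\mathbb{N}^g$ such that for every nonempty $\sigma\subseteq[g]$ there is some $i\in\sigma$ with $a_i<|C_i\cap\mathcal{C}_\sigma|$ (if $g=0$, the only one is $()$). $P^*(\mathcal{C})$ is the set of coparking functions. The $h$-vector $h(M)=(h_0,\dots,h_d)$, $d=r(M)$, is defined by $\sum_{k=0}^d h_k t^{d-k}=\sum_{i=0}^d f_{i-1}(t-1)^{d-i}$, where $f_{i-1}$ is the number of independent sets of $M$ of size $i$. A sequence $(h_0,h_1,\dots)$ is a *pure O-sequence* if for some $n$ there is a finite nonempty subset $\Delta\subseteq\mathbb{N}^n$, closed under passing to componentwise smaller vectors, all of whose (componentwise) maximal elements have the same coordinate sum, such that $h_i$ is the number of elements of $\Delta$ with coordinate sum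 $i$ for all $i$ (trailing zeros in the sequence are disregarded). *)

(* Defs.v *)
From Stdlib Require Import Relation_Operators.
From mathcomp Require Import all_boot all_order all_algebra finmap.
Set Implicit Arguments.
Unset Strict Implicit.
Unset Printing Implicit Defensive.
Import Order.TTheory GRing.Theory Num.Theory.

(* The ground set of a matroid is the whole of the finite type T. *)
Record matroid (T : finType) := Matroid {
  indep : {set {set T}};
  indep0 : set0 \in indep;
  indepS : forall I J : {set T}, J \in indep -> I \subset J -> I \in indep;
  indepU : forall I J : {set T}, I \in indep -> J \in indep -> #|I| < #|J| ->
    exists2 e, e \in J :\: I & e |: I \in indep
}.

Section Matroid.
Variables (T : finType) (M : matroid T).

Definition rank : nat := \max_(I in indep M) #|I|.

Definition corank : nat := #|T| - rank.

Definition bases : {set {set T}} :=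
  [set B | maxset (fun I : {set T} => I \in indep M) B].

Definition circuits : {set {set T}} :=
  [set D | minset (fun X : {set T} => X \notin indep M) D].

Definition is_cycle (X : {set T}) : Prop :=
  exists2 S : {set {set T}}, S \subset circuits & X = cover S.

(* The number of independent sets of size i, i.e. f_(i-1) in the usual shifted
   indexing of f-vectors. *)
Definition nb_indep (i : nat) : nat := #|[set I in indep M | #|I| == i]|.

Definition h_poly : {poly int} :=
  (\sum_(i < rank.+1) ((nb_indep i)%:Z)%:P * ('X - 1) ^+ (rank - i))%R.

(* (h_0, ..., h_d), d = rank: h_k is the coefficient of t^(d-k), see h_vectorP. *)
Definition h_vector : seq int :=
  mkseq (fun k => h_poly`_(rank - k))%R rank.+1.

Lemma h_vectorP :
  (\sum_(k < rank.+1) (h_vector`_k)%:P * 'X^(rank - k))%R =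
  (\sum_(i < rank.+1) ((nb_indep i)%:Z)%:P * ('X - 1) ^+ (rank - i))%R.
Proof.
rewrite -[RHS]/h_poly.
have szh : size h_poly <= rank.+1.
  apply: (leq_trans (size_sum _ _ _)); apply/bigmax_leqP => i _.
  rewrite mul_polyC; apply: (leq_trans (size_scale_leq _ _)).
  by rewrite -polyC1 size_exp_XsubC ltnS leq_subr.
have -> : h_poly = (\poly_(i < rank.+1) h_poly`_i)%R.
  apply/polyP => i; rewrite coef_poly; case: ltnP => // le_i.
  by rewrite nth_default // (leq_trans szh).
rewrite poly_def (reindex_inj rev_ord_inj) /=; apply: eq_bigr => k _.
rewrite nth_mkseq; last by rewrite subSS ltnS leq_subr.
by rewrite subSS subKn -1?ltnS // mul_polyC.
Qed.

End Matroid.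

Section UniqueUnion.
Variables (T : finType) (g : nat).

Definition uunion (A : {ffun 'I_g -> {set T}}) (s : {set 'I_g}) : {set T} :=
  [set e in \bigcup_(i in s) A i | #|[set i in s | e \in A i]| == 1].

Definition coparking (C : {ffun 'I_g -> {set T}}) (a : {ffun 'I_g -> nat}) :
    Prop :=
  forall s : {set 'I_g}, s != set0 ->
    exists2 i, i \in s & a i < #|C i :&: uunion C s|.

End UniqueUnion.

Definition cycle_system (T : finType) (M : matroid T)
    (C : {ffun 'I_(corank M) -> {set T}}) : Prop :=
  (forall i, is_cycle M (C i)) /\
  (forall s : {set 'I_(corank M)}, s != set0 -> uunion C s \notin indep M).

Definition linear_order (T : Type) (le : rel T) : Prop :=
  [/\ total le, antisymmetric le & transitive le].

Definition update (I : finType) (A : Type) (f : {ffun I -> A}) (i : I) (x : A) :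
    {ffun I -> A} := [ffun j => if j == i then x else f j].

Section Procedures.
Variables (T : finType) (le : rel T) (g : nat).

(* The current sigma, the current sets C_j, and the output under construction
   (together with any other variable of the procedure). *)
Definition state (X : Type) : Type :=
  ({set 'I_g} * {ffun 'I_g -> {set T}} * X)%type.

Definition running X (st : state X) : Prop := st.1.1 != set0.

Definition selects (C : {ffun 'I_g -> {set T}}) (s : {set 'I_g}) (e : T)
    (i : 'I_g) : Prop :=
  [/\ e \in uunion C s, forall f, f \in uunion C s -> le f e,
      i \in s & e \in C i].

Variant basis_step (B : {set T}) :
    state {ffun 'I_g -> nat} -> state {ffun 'I_g -> nat} -> Prop :=
| BasisStepOut s C (a : {ffun 'I_g -> nat}) e i of selects C s e i & e \notin B :
    basis_step B (s, C, a) (s :\ i, C, a)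
| BasisStepIn s C (a : {ffun 'I_g -> nat}) e i of selects C s e i & e \in B :
    basis_step B (s, C, a) (s, update C i (C i :\ e), update a i (a i).+1).

Variant coparking_step :
    state ({ffun 'I_g -> int} * {set T}) ->
    state ({ffun 'I_g -> int} * {set T}) -> Prop :=
| CoparkingStepNeg s C (a : {ffun 'I_g -> int}) (B : {set T}) e i
    of selects C s e i & (a i - 1 < 0)%R :
    coparking_step (s, C, (a, B))
                   (s :\ i, C, (update a i (a i - 1)%R, B :\ e))
| CoparkingStepNneg s C (a : {ffun 'I_g -> int}) (B : {set T}) e i
    of selects C s e i & (0 <= a i - 1)%R :
    coparking_step (s, C, (a, B))
                   (s, update C i (C i :\ e), (update a i (a i - 1)%R, B)).

(* The loop "while sigma is nonempty, do step", started at st0, never gets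
   stuck or has to make a choice, stops, and does so with the third component
   of the state satisfying post. *)
Definition loop_computes X (step : state X -> state X -> Prop) (st0 : state X)
    (post : X -> Prop) : Prop :=
  [/\ forall st, clos_refl_trans _ step st0 st -> running st ->
        exists! st', step st st',
      Acc (fun st' st => step st st') st0
    & exists st, [/\ clos_refl_trans _ step st0 st, ~ running st & post st.2]].

Definition basis_to_coparking (C : {ffun 'I_g -> {set T}}) (B : {set T})
    (a : {ffun 'I_g -> nat}) : Prop :=
  loop_computes (basis_step B) ([set: 'I_g], C, [ffun=> 0]) (fun x => x = a).

Definition coparking_to_basis (C : {ffun 'I_g -> {set T}})
    (a : {ffun 'I_g -> nat}) (B : {set T}) : Prop :=
  loop_computes coparking_step
    ([set: 'I_g], C, ([ffun i => (a i)%:Z%R], [set: T])) (fun x => x.2 = B).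

End Procedures.

Local Open Scope fset_scope.

(* A sequence is given by a finite list, implicitly continued by zeros. *)
Definition pure_O_sequence (h : seq int) : Prop :=
  exists (n : nat) (Delta : {fset {ffun 'I_n -> nat}}),
    let le_vec (u v : {ffun 'I_n -> nat}) := forall j, u j <= v j in
    let weight (v : {ffun 'I_n -> nat}) := \sum_j v j in
    let maximal v := v \in Delta /\
      forall w, w \in Delta -> le_vec v w -> w = v in
    [/\ Delta != fset0,
        forall u v, v \in Delta -> le_vec u v -> u \in Delta,
        forall u v, maximal u -> maximal v -> weight u = weight v
      & forall i, (h`_i)%R = (#|` [fset v in Delta | weight v == i]|)%:Z%R].

(* Main.v *)
(* Each pass through either loop selects an element [e] of the unique union and
   deletes it from, or contracts it in, the current minor; the remaining [C_j]
   are cycles of that minor, with the same number of them as its corank, and the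
   condition defining coparking functions is inherited in both directions.  So
   the two procedures share one transcript, which determines and is determined
   by either the basis or the coparking function.

   The basis-to-coparking procedure makes sense for every independent set [I] in
   place of a basis.  If [K] is the set of contracted elements in the transcript
   of a basis [B], then the independent sets with that transcript are exactly
   those with [K <= I <= B], and [#|K|] is the coordinate sum of the coparking
   function.  Hence the independence complex is partitioned into the intervals
   [[K, B]], and h_k counts the coparking functions of coordinate sum k.

   For purity, coordinates of a coparking function are raised one at a time until
   the sum is [#|\bigcup_i C_i| - g]. *)
Require Import Defs.
From mathcomp Require Import all_boot all_order all_algebra finmap.
From Stdlib Require Import Relation_Operators Operators_Properties.
Set Implicit Arguments.
Unset Strict Implicit.
Unset Printing Implicit Defensive.
Import Order.TTheory GRing.Theory Num.Theory.

(** * Deterministic terminating loops *)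

Section Loop.
Variables (T : finType) (g : nat) (X : Type).
Variable step : state T g X -> state T g X -> Prop.

Lemma loop_computes_halt st (post : X -> Prop) :
  ~ running st -> (forall st', ~ step st st') -> post st.2 ->
  loop_computes step st post.
Proof.
move=> nrun nstep hpost; split.
- move=> st' /(@clos_rt_rt1n _ _ _ _)[//|y z hy _].
  by case: (nstep _ hy).
- by constructor => y /nstep.
- by exists st; split=> //; apply: rt_refl.
Qed.

(** A forced step pulls all three clauses back from the next state, so a loop can be analysed by
    induction along its transcript. *)
Lemma loop_computes_next st st' (post : X -> Prop) :
  step st st' -> (forall st'', step st st'' -> st' = st'') ->
  loop_computes step st' post -> loop_computes step st post.
Proof.
move=> hst uniq_st [hrun hacc [fin [hfin nrun hpost]]]; split.
- move=> y /(@clos_rt_rt1n _ _ _ _)[_|z w hz /(@clos_rt1n_rt _ _ _ _) hw].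
    by exists st'; split.
  by rewrite -(uniq_st _ hz) in hw; apply: hrun.
- by constructor => y /uniq_st <-.
- exists fin; split=> //; apply: rt_trans hfin; exact: rt_step.
Qed.

End Loop.

(** * Unique unions, and coparking functions on a subset of the indices *)

Section UniqueUnion.
Variables (T : finType) (g : nat).
Implicit Types (C : {ffun 'I_g -> {set T}}) (s t : {set 'I_g}).
Implicit Types a b : {ffun 'I_g -> nat}.

Lemma uunionP C s e :
  reflect (exists i, [/\ i \in s, e \in C i
                       & forall j, j \in s -> e \in C j -> j = i])
          (e \in uunion C s).
Proof.
rewrite inE; apply: (iffP andP) => [[_ /cards1P[i Ei]]|[i [si Ci ui]]].
  have: i \in [set i in s | e \in C i] by rewrite Ei set11.
  rewrite inE => /andP[si Ci]; exists i; split=> // j sj Cj.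
  by apply/set1P; rewrite -Ei inE sj Cj.
split; first by apply/bigcupP; exists i.
apply/cards1P; exists i; apply/setP => j; rewrite !inE.
by apply/andP/eqP => [[]|->]; first exact: ui.
Qed.

(** An element of [C i] covered once over [s] lies in no other [C j] there, hence in none over the
    smaller [t]. *)
Lemma uunion_sub C s t i :
  t \subset s -> i \in t -> C i :&: uunion C s \subset C i :&: uunion C t.
Proof.
move=> /subsetP ts ti; apply/subsetP => e /setIP[Ci /uunionP[k [sk Ck uk]]].
rewrite in_setI Ci; apply/uunionP; exists i; split=> // j tj Cj.
by rewrite (uk _ (ts _ tj) Cj) (uk _ (ts _ ti) Ci).
Qed.

Lemma setI_uunion C s i : i \in s ->
  C i :&: uunion C s = C i :\: \bigcup_(j in s :\ i) C j.
Proof.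
move=> si; apply/setP => e; rewrite in_setI in_setD andbC.
case Ci: (e \in C i); rewrite ?andbF // !andbT.
apply/uunionP/idP => [[k [sk Ck uk]]|nU].
  apply/bigcupP => -[j]; rewrite !inE => /andP[ji sj] Cj.
  by case/eqP: ji; rewrite (uk _ sj Cj) (uk _ si Ci).
exists i; split=> // j sj Cj; apply/eqP; apply: contraNT nU => ji.
by apply/bigcupP; exists j; rewrite // !inE ji.
Qed.

(** Coordinates outside [s] are left free, so the condition can be followed while the procedures
    discard indices. *)
Definition coparking_on C s a : Prop :=
  forall t, t \subset s -> t != set0 ->
    exists2 i, i \in t & a i < #|C i :&: uunion C t|.

Lemma coparking_onT C a : coparking C a <-> coparking_on C [set: 'I_g] a.
Proof. by split=> [h t _|h t]; [exact: h | apply: h; exact: subsetT]. Qed.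

Lemma coparking_onS C s t a :
  t \subset s -> coparking_on C s a -> coparking_on C t a.
Proof. by move=> ts h u ut; apply: h; apply: subset_trans ts. Qed.

Lemma coparking_on_le C s a b :
  (forall i, b i <= a i) -> coparking_on C s a -> coparking_on C s b.
Proof.
move=> ba h t ts t0; have [i ti ai] := h t ts t0.
by exists i => //; apply: leq_ltn_trans ai.
Qed.

(** Subsets of [s] containing [i] have [i] as witness by [uunion_sub]; all others lie in
    [s :\ i]. *)
Lemma coparking_on_setD1 C s a i :
  i \in s -> a i < #|C i :&: uunion C s| ->
  coparking_on C (s :\ i) a -> coparking_on C s a.
Proof.
move=> si ai h t ts t0; have [ti|nti] := boolP (i \in t).
  exists i => //; apply: leq_trans ai _; apply: subset_leq_card.
  exact: uunion_sub.
apply: h => //; apply/subsetP => j tj; rewrite !inE (subsetP ts) // andbT.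
by apply: contraNneq nti => <-.
Qed.

Lemma coparking_on_ext C s a b :
  {in s, a =1 b} -> coparking_on C s a -> coparking_on C s b.
Proof.
move=> ab h t ts t0; have [i ti ai] := h t ts t0; exists i => //.
by rewrite -ab // (subsetP ts).
Qed.

(* A coordinate [i] with [a i < #|C i :&: uunion C s|] can be raised to
   [#|C i :&: uunion C s| - 1], after which [s :\ i] is extended on its own. *)
Lemma coparking_on_extend C s a : coparking_on C s a ->
  exists b, [/\ coparking_on C s b, forall i, a i <= b i
    & \sum_(i in s) b i + #|s| = #|\bigcup_(i in s) C i|].
Proof.
have [n] := ubnP #|s|; elim: n s a => // n IH s a; rewrite ltnS => sn ha.
have [->|s0] := eqVneq s set0.
  exists a; split=> //; last by rewrite !big_set0 !cards0.
  by move=> t; rewrite subset0 => /eqP->; rewrite eqxx.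
have [i si ai] := ha s (subxx _) s0.
have lt_n : #|s :\ i| < n by rewrite (cardsD1 i) si in sn.
have [b [hb ab sb]] := IH _ _ lt_n (coparking_onS (subsetDl _ _) ha).
exists (update b i (#|C i :&: uunion C s|).-1); split.
- apply: (@coparking_on_setD1 _ _ _ i) => //.
    by rewrite ffunE eqxx prednK // (leq_trans _ ai).
  apply: coparking_on_ext hb => j; rewrite !inE ffunE => /andP[/negPf -> //].
- move=> j; rewrite ffunE; case: eqP => [->|//].
  by rewrite -ltnS prednK // (leq_trans _ ai).
- rewrite !(big_setD1 i si) /= ffunE eqxx.
  rewrite (eq_bigr b); last first.
    by move=> j; rewrite !inE ffunE => /andP[/negPf -> //].
  rewrite setI_uunion // in ai *; set U := \bigcup_(j in s :\ i) C j in sb ai *.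
  (* The part of [C i] outside [U] has one element more than the raised value: exactly what [i] adds
     to the left side. *)
  have -> : #|C i :|: U| = #|U| + #|C i :\: U|.
    have := cardsID U (C i :|: U).
    by rewrite setDUl setDv setU0 setIUl setIid (setUidPr (subsetIr _ _)) => <-.
  rewrite -sb (cardsD1 i s) si -{2}(@prednK #|C i :\: U|) //; last first.
    by apply: leq_ltn_trans ai.
  by rewrite add1n !addnS [in RHS]addnC addnA.
Qed.

End UniqueUnion.

Lemma disjoints1U (T : finType) (x : T) (A B : {set T}) :
  [disjoint x |: A & B] = (x \notin B) && [disjoint A & B].
Proof. by rewrite -disjointU1; apply: eq_disjoint => y; rewrite !inE. Qed.

(** * The common transcript of the two procedures *)

Section Run.
Variables (T : finType) (le : rel T) (g : nat).
Hypothesis le_lin : linear_order le.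
Implicit Types (C : {ffun 'I_g -> {set T}}) (s t : {set 'I_g}).
Implicit Types (a b : {ffun 'I_g -> nat}) (B I K X : {set T}).

Lemma selects_uniq C s e i j :
  selects le C s e i -> j \in s -> e \in C j -> j = i.
Proof.
case=> /uunionP[k [sk Ck uk]] _ si Ci sj Cj.
by rewrite (uk _ sj Cj) (uk _ si Ci).
Qed.

Lemma selects_inj C s e i e' i' :
  selects le C s e i -> selects le C s e' i' -> e = e' /\ i = i'.
Proof.
move=> h h'; have [_ anti _] := le_lin.
case: (h) (h') => Ue maxe si Ci [Ue' maxe' si' Ci'].
have ee : e = e' by apply: anti; rewrite maxe ?maxe'.
by subst e'; split=> //; apply: selects_uniq h' _ _.
Qed.

Lemma selects_ex C s : uunion C s != set0 -> exists e i, selects le C s e i.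
Proof.
have [tot _ tr] := le_lin.
(* [extremumP] gives a least element, so it is applied to the reversed order. *)
have refl : reflexive (fun x y => le y x) by move=> x; have := tot x x; rewrite orbb.
have tr' : transitive (fun x y => le y x) by move=> x y z /[swap]; apply: tr.
have tot' : total (fun x y => le y x) by move=> x y; apply: tot.
case/set0Pn => e0 Ue0; have [e Ue maxe] :=
  extremumP (P := mem (uunion C s)) (fun x : T => x) refl tr' tot' Ue0.
by have /uunionP[i [si Ci _]] := Ue; exists e, i; split.
Qed.

(** Over [s] the element [e] lies in [C i] alone, so erasing it there erases it everywhere, and no
    other element changes multiplicity. *)
Lemma uunion_setD1 C s e i t : selects le C s e i -> t \subset s ->
  uunion (update C i (C i :\ e)) t = uunion C t :\ e.
Proof.
move=> sel /subsetP ts; apply/setP => f; rewrite in_setD1.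
have CE j : j \in s -> (f \in update C i (C i :\ e) j) = (f != e) && (f \in C j).
  move=> sj; rewrite ffunE; case: eqP => [->|ji]; first by rewrite in_setD1.
  case: eqP => [->|//]; apply/negP => Cj; case: ji; exact: selects_uniq sel sj Cj.
apply/uunionP/andP => [[j [tj]]|[fe /uunionP[j [tj Cj uj]]]].
  rewrite CE ?ts // => /andP[fe Cj] uj; split=> //; apply/uunionP; exists j.
  by split=> // k tk Ck; apply: uj; rewrite // CE ?ts // fe.
exists j; rewrite CE ?ts // fe; split=> // k tk; rewrite CE ?ts // => /andP[_].
exact: uj.
Qed.

(** If [i \in t], then [e] is in [C i :&: uunion C t], whose size drops by exactly one; this offsets
    the increment at [i]. For other [j] in [s], [e] is not in [C j] and nothing changes. *)
Lemma coparking_on_in C s e i a : selects le C s e i ->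
  coparking_on (update C i (C i :\ e)) s a
    <-> coparking_on C s (update a i (a i).+1).
Proof.
move=> sel; have [_ _ si Ci] := sel.
have E t j : t \subset s -> j \in t ->
    (a j < #|update C i (C i :\ e) j :&: uunion (update C i (C i :\ e)) t|)
      = (update a i (a i).+1 j < #|C j :&: uunion C t|).
  move=> ts tj; have sj := subsetP ts _ tj; rewrite (uunion_setD1 sel) // !ffunE.
  case: eqP => [ji|ji].
    rewrite {}ji in tj *; rewrite -setDIl [in RHS](cardsD1 e).
    suff -> : e \in C i :&: uunion C t by rewrite add1n ltnS.
    rewrite in_setI Ci; apply/uunionP; exists i; split=> // k tk Ck.
    exact: selects_uniq sel (subsetP ts _ tk) Ck.
  congr (_ < #|pred_of_set _|); apply/setP => f; rewrite !in_setI in_setD1.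
  case: eqP => [->|] //=; case Cj: (e \in C j) => //.
  by case: ji; apply: selects_uniq sel sj Cj.
split=> h t ts t0; have [j tj aj] := h t ts t0; exists j => //.
  by rewrite -E.
by rewrite E.
Qed.

Lemma coparking_on_out C s e i a : selects le C s e i -> a i = 0 ->
  coparking_on C (s :\ i) a -> coparking_on C s a.
Proof.
move=> [Ue _ si Ci] ai; apply: coparking_on_setD1 => //.
by rewrite ai; apply/card_gt0P; exists e; rewrite in_setI Ci.
Qed.

(* The common transcript of the two procedures from the indices [s] and the
   sets [C]: [a] is the coparking function, [X] the set of selected elements
   outside the basis and [K] the set of selected elements in the basis. *)
Inductive run : {set 'I_g} -> {ffun 'I_g -> {set T}} ->
    {ffun 'I_g -> nat} -> {set T} -> {set T} -> Prop :=
| RunStop C : run set0 C [ffun=> 0] set0 set0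
| RunOut s C e i a X K of selects le C s e i & run (s :\ i) C a X K :
    run s C a (e |: X) K
| RunIn s C e i a X K of selects le C s e i
    & run s (update C i (C i :\ e)) a X K :
    run s C (update a i (a i).+1) X (e |: K).

Lemma run_sub s C a X K : run s C a X K ->
  X :|: K \subset \bigcup_(i in s) C i.
Proof.
elim=> {s C a X K} [C|s C e i a X K [_ _ si Ci] _ IH|s C e i a X K [_ _ si Ci] _ IH].
- by rewrite big_set0 setU0.
- rewrite -setUA subUset sub1set; apply/andP; split; first by apply/bigcupP; exists i.
  by apply: subset_trans IH _; rewrite (big_setD1 i si) subsetUr.
- rewrite setUCA subUset sub1set; apply/andP; split; first by apply/bigcupP; exists i.
  apply: subset_trans IH _; apply/bigcupsP => j sj; apply: subset_trans (bigcup_sup j sj).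
  by rewrite ffunE; case: eqP => [->|//]; rewrite subsetDl.
Qed.

(** Later selections come from sets with index in [s :\ i], none of which contains [e]. *)
Lemma run_out_fresh s C e i a X K : selects le C s e i ->
  run (s :\ i) C a X K -> e \notin X :|: K.
Proof.
move=> sel /run_sub /subsetP h; apply/negP => /h /bigcupP[j].
by rewrite !inE => /andP[/eqP ji sj] /(selects_uniq sel sj).
Qed.

Lemma run_in_fresh s C e i a X K : selects le C s e i ->
  run s (update C i (C i :\ e)) a X K -> e \notin X :|: K.
Proof.
move=> sel /run_sub /subsetP h; apply/negP => /h /bigcupP[j sj].
rewrite ffunE; case: eqP => [_|ji]; first by rewrite !inE eqxx.
by move/(selects_uniq sel sj).
Qed.

Lemma run_supp s C a X K i : run s C a X K -> i \notin s -> a i = 0.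
Proof.
elim=> {s C a X K} [C _|s C e j a X K _ _ IH ni|s C e j a X K [_ _ sj _] _ IH ni].
- by rewrite ffunE.
- by apply: IH; rewrite !inE negb_and ni orbT.
- by rewrite ffunE; case: eqP ni => [->|_ /IH //]; rewrite sj.
Qed.

Lemma run_cardK s C a X K : run s C a X K -> #|K| = \sum_i a i.
Proof.
elim=> {s C a X K} [C|//|s C e i a X K sel r IH].
  by rewrite cards0 big1 // => i _; rewrite ffunE.
have := run_in_fresh sel r; rewrite inE negb_or cardsU1 => /andP[_ ->].
rewrite IH !(bigD1 i (P := xpredT)) //= ffunE eqxx addnA add1n; congr (_ + _).
by apply: eq_bigr => j /negPf ji; rewrite ffunE ji.
Qed.

Lemma run_disj s C a X K : run s C a X K -> [disjoint X & K].
Proof.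
elim=> {s C a X K} [C|s C e i a X K sel r IH|s C e i a X K sel r IH].
- by rewrite disjoints_subset sub0set.
- have := run_out_fresh sel r; rewrite inE negb_or => /andP[_ eK].
  by rewrite disjoints1U eK.
- have := run_in_fresh sel r; rewrite inE negb_or => /andP[eX _].
  by rewrite disjoint_sym disjoints1U eX disjoint_sym.
Qed.

Lemma run_coparking s C a X K : run s C a X K -> coparking_on C s a.
Proof.
elim=> {s C a X K} [C t|s C e i a X K sel r IH|s C e i a X K sel r IH].
- by rewrite subset0 => /eqP->; rewrite eqxx.
- apply: coparking_on_out sel _ IH; apply: run_supp r _.
  by rewrite !inE eqxx.
- exact/(coparking_on_in _ sel).
Qed.

(** The order fixes the selected pair, and [a] fixes the kind of step: after [RunOut] the index [i]
    is never selected again, so [a i = 0], while [RunIn] makes [a i] positive. *)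
Lemma run_inj s C a X K X' K' :
  run s C a X K -> run s C a X' K' -> X = X' /\ K = K'.
Proof.
move=> r; elim: r X' K' =>
  {s C a X K} [C
    |s C e i a X K sel r IH
    |s C e i a X K sel r IH] X' K' r'.
- move Es: set0 r' => s r'; case: r' Es => {s} // s ? ? ? ? ? ? [_ _ + _] _ Es;
  by rewrite -Es inE.
- have a0 : a i = 0 by apply: run_supp r _; rewrite !inE eqxx.
  move Ea: a r' => b r'.
  case: r' Ea sel r IH =>
    {s C b X' K'} [C
      |s C e' i' b X' K' sel' r'
      |s C e' i' b X' K' sel' r'] Ea sel r IH.
  + by case: sel => _ _; rewrite inE.
  + case: (selects_inj sel sel') => ? ?; subst e' i' b.
    by case: (IH _ _ r') => -> ->.
  + case: (selects_inj sel sel') => ? ?; subst e' i'.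
    by move: a0; rewrite Ea ffunE eqxx.
- move Ea: (update _ _ _) r' => b r'.
  case: r' Ea sel r IH =>
    {s C b X' K'} [C
      |s C e' i' b X' K' sel' r'
      |s C e' i' b X' K' sel' r'] Ea sel r IH.
  + by case: sel => _ _; rewrite inE.
  + case: (selects_inj sel sel') => ? ?; subst e' i'.
    have : b i = 0 by apply: run_supp r' _; rewrite !inE eqxx.
    by rewrite -Ea ffunE eqxx.
  + case: (selects_inj sel sel') => ? ?; subst e' i'.
    have ab : a = b.
      apply/ffunP => j; move/ffunP/(_ j): Ea; rewrite !ffunE.
      by case: eqP => [->[]|].
    by subst b; case: (IH _ _ r') => -> ->.
Qed.

(** Here membership of the selected element in [I] fixes the kind of each step. *)
Lemma run_fun s C I a X K a' X' K' :
    run s C a X K -> K \subset I -> [disjoint X & I] ->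
    run s C a' X' K' -> K' \subset I -> [disjoint X' & I] ->
  [/\ a = a', X = X' & K = K'].
Proof.
move=> r; elim: r a' X' K' =>
  {s C a X K} [C
    |s C e i a X K sel r IH
    |s C e i a X K sel r IH] a' X' K' KI XI r'.
- move Es: set0 r' => s r'; case: r' Es => {s} // s ? ? ? ? ? ? [_ _ + _] _ Es;
  by rewrite -Es inE.
- case: r' sel r IH =>
    {s C a' X' K'} [C
      |s C e' i' b X' K' sel' r'
      |s C e' i' b X' K' sel' r'] sel r IH K'I X'I.
  + by case: sel => _ _; rewrite inE.
  + case: (selects_inj sel sel') => ? ?; subst e' i'.
    move: XI X'I; rewrite !disjoints1U => /andP[_ XI] /andP[_ X'I].
    by case: (IH _ _ _ KI XI r' K'I X'I) => -> -> ->.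
  + case: (selects_inj sel sel') => ? ?; subst e' i'.
    by move: XI K'I; rewrite disjoints1U subUset sub1set => /andP[/negPf->].
- case: r' sel r IH =>
    {s C a' X' K'} [C
      |s C e' i' b X' K' sel' r'
      |s C e' i' b X' K' sel' r'] sel r IH K'I X'I.
  + by case: sel => _ _; rewrite inE.
  + case: (selects_inj sel sel') => ? ?; subst e' i'.
    by move: X'I KI; rewrite disjoints1U subUset sub1set => /andP[/negPf->].
  + case: (selects_inj sel sel') => ? ?; subst e' i'.
    move: KI K'I; rewrite !subUset => /andP[_ KI] /andP[_ K'I].
    by case: (IH _ _ _ KI XI r' K'I X'I) => -> -> ->.
Qed.

(** The start value [a0] is arbitrary so that the induction can absorb increments already made. *)
Lemma run_basis_to_coparking B s C a X K a0 :
  run s C a X K -> K \subset B -> [disjoint X & B] ->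
  loop_computes (basis_step le B) (s, C, a0)
    (fun b => b = [ffun i => a0 i + a i]).
Proof.
move=> r; elim: r a0 =>
  {s C a X K} [C
    |s C e i a X K sel r IH
    |s C e i a X K sel r IH] a0 KB XB.
- apply: loop_computes_halt => [|st' h|]; first by rewrite /running eqxx.
    move Es: (set0, C, a0) h => st h;
      case: h Es => s C' b e i [_ _ si _] _ [Es _ _];
    by rewrite -Es inE in si.
  by apply/ffunP => i; rewrite !ffunE addn0.
- move: XB; rewrite disjoints1U => /andP[eB XB].
  apply: loop_computes_next (BasisStepOut a0 sel eB) _ (IH _ KB XB) => st' h.
  move Est: (s, C, a0) h => st h;
    case: h Est => s1 C1 b e' i' sel' eB' [? ? ?]; subst.
    by case: (selects_inj sel sel') => ? ?; subst.
  by case: (selects_inj sel sel') => ? ?; subst; rewrite eB' in eB.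
- move: KB; rewrite subUset sub1set => /andP[eB KB].
  have -> : [ffun j => a0 j + update a i (a i).+1 j] =
            [ffun j => update a0 i (a0 i).+1 j + a j].
    by apply/ffunP => j; rewrite !ffunE; case: eqP => // ->; rewrite addnS.
  apply: loop_computes_next (BasisStepIn a0 sel eB) _ (IH _ KB XB) => st' h.
  move Est: (s, C, a0) h => st h;
    case: h Est => s1 C1 b e' i' sel' eB' [? ? ?]; subst.
    by case: (selects_inj sel sel') => ? ?; subst; rewrite eB in eB'.
  by case: (selects_inj sel sel') => ? ?; subst.
Qed.

(** Agreement of [b] with [a] is asked only on [s], because a discarded index is left with value
    [-1]. *)
Lemma run_coparking_to_basis s C a X K (b : {ffun 'I_g -> int}) B :
  run s C a X K -> {in s, forall i, b i = ((a i)%:Z)%R} ->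
  loop_computes (@coparking_step T le g) (s, C, (b, B)) (fun x => x.2 = B :\: X).
Proof.
move=> r; elim: r b B =>
  {s C a X K} [C
    |s C e i a X K sel r IH
    |s C e i a X K sel r IH] b B ba.
- apply: loop_computes_halt => [|st' h|]; first by rewrite /running eqxx.
    move Es: (set0, C, (b, B)) h => st h;
      case: h Es => s C' b' B' e i [_ _ si _] _ [Es _ _];
    by rewrite -Es inE in si.
  by rewrite setD0.
- have [_ _ si _] := sel.
  have a0 : a i = 0 by apply: run_supp r _; rewrite !inE eqxx.
  have bi : (b i - 1 < 0)%R by rewrite ba // a0.
  rewrite -setDDl.
  apply: loop_computes_next (CoparkingStepNeg B sel bi) _ (IH _ _ _) => [st' h|j].
    move Est: (s, C, (b, B)) h => st h;
      case: h Est => s1 C1 b' B' e' i' sel' bi' [? ? ? ?]; subst.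
      by case: (selects_inj sel sel') => ? ?; subst.
    by case: (selects_inj sel sel') => ? ?; subst; rewrite ltNge bi' in bi.
  by rewrite !inE ffunE => /andP[/negPf-> sj]; exact: ba.
- have [_ _ si _] := sel.
  have bi : (0 <= b i - 1)%R by rewrite ba // ffunE eqxx -addn1 PoszD addrK.
  apply: loop_computes_next (CoparkingStepNneg B sel bi) _ (IH _ _ _) => [st' h|j sj].
    move Est: (s, C, (b, B)) h => st h;
      case: h Est => s1 C1 b' B' e' i' sel' bi' [? ? ? ?]; subst.
      by case: (selects_inj sel sel') => ? ?; subst; rewrite ltNge bi in bi'.
    by case: (selects_inj sel sel') => ? ?; subst.
  rewrite ffunE; case: eqP => [->|/eqP/negPf ji]; last by rewrite ba // ffunE ji.
  by rewrite ba // ffunE eqxx -addn1 PoszD addrK.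
Qed.

(** Termination measure: discarding an index lowers the first summand, erasing an element lowers the
    second. *)
Definition run_measure C s := #|s| + \sum_(i in s) #|C i|.

Lemma run_measure_out C s e i : selects le C s e i ->
  run_measure C (s :\ i) < run_measure C s.
Proof.
move=> [_ _ si _]; rewrite /run_measure (big_setD1 i si) (cardsD1 i s) si /=.
by rewrite add1n addSn ltnS leq_add2l leq_addl.
Qed.

Lemma run_measure_in C s e i : selects le C s e i ->
  run_measure (update C i (C i :\ e)) s < run_measure C s.
Proof.
move=> [_ _ si Ci]; rewrite /run_measure ltn_add2l !(big_setD1 i si) /= ffunE eqxx.
rewrite (cardsD1 e (C i)) Ci add1n addSn ltnS leq_add2l.
by apply: leq_sum => j; rewrite !inE ffunE => /andP[/negPf->].
Qed.

End Run.

(** * Bases, and cycles in minors *)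

Section Matroid.
Variables (T : finType) (M : matroid T).
Implicit Types (A B D I J K X : {set T}).

(** Iterated augmentation. The bound [K \subset I :|: J] later keeps a new basis off the deleted
    elements. *)
Lemma indep_extend I J : I \in indep M -> J \in indep M -> #|I| <= #|J| ->
  exists K, [/\ K \in indep M, I \subset K, K \subset I :|: J & #|K| = #|J|].
Proof.
move=> hI hJ; have [n] := ubnP (#|J| - #|I|); elim: n I hI => // n IH I hI ltn.
rewrite leq_eqVlt => /orP[/eqP IJ|IJ].
  by exists I; split=> //; apply: subsetUl.
have [e /setDP[eJ eI] heI] := indepU hI hJ IJ.
have ceI : #|e |: I| = #|I|.+1 by rewrite cardsU1 eI.
have [||K [hK eIK KIJ cK]] := IH _ heI; rewrite ?ceI //.
  by rewrite -ltnS (leq_trans _ ltn) // ltnS ltn_sub2l.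
exists K; split=> //.
  by apply: subset_trans eIK; apply: subsetUr.
apply: subset_trans KIJ _; rewrite -setUA subUset subxx andbT sub1set.
by rewrite inE eJ orbT.
Qed.

Lemma rank_max I : I \in indep M -> #|I| <= rank M.
Proof. exact: (@leq_bigmax_cond _ (mem (indep M)) (fun I : {set T} => #|I|)). Qed.

Lemma rank_ex : exists2 B, B \in indep M & #|B| = rank M.
Proof.
have [|B hB EB] := @eq_bigmax_cond _ (mem (indep M)) (fun I : {set T} => #|I|).
  by apply/card_gt0P; exists set0; apply: indep0.
by exists B; rewrite // -EB.
Qed.

Lemma basesP B : reflect (B \in indep M /\ #|B| = rank M) (B \in bases M).
Proof.
rewrite inE; apply: (iffP maxsetP) => [[hB maxB]|[hB cB]]; split=> //.
  have [J hJ cJ] := rank_ex.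
  have [|K [hK BK _ cK]] := indep_extend hB hJ; first by rewrite cJ rank_max.
  by rewrite -cJ -cK (maxB K).
move=> A hA BA; apply/eqP; rewrite eq_sym eqEcard BA cB.
exact: rank_max.
Qed.

Lemma corankE : corank M + rank M = #|T|.
Proof. by have [B _ cB] := rank_ex; rewrite subnK // -cB max_card. Qed.

(** Take for [I] a circuit of the cycle through [x], minus [x]. Being spanned by the rest of [A] is
    the form of cyclicity that passes to minors. *)
Lemma cycle_dependence A x : is_cycle M A -> x \in A ->
  exists I, [/\ I \in indep M, I \subset A :\ x & x |: I \notin indep M].
Proof.
case=> S /subsetP SC -> /bigcupP[D DS xD].
have := SC _ DS; rewrite inE => /minsetP[hD minD].
exists (D :\ x); split; last by rewrite setD1K.
  apply: contraT => hDx; have /setP/(_ x) := minD _ hDx (subsetDl _ _).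
  by rewrite !inE eqxx xD.
by apply: setSD; apply: (bigcup_max D).
Qed.

Section Minor.
Variable g : nat.
Implicit Types (C : {ffun 'I_g -> {set T}}) (s t : {set 'I_g}).
Implicit Types (a : {ffun 'I_g -> nat}).

(* After contracting [K] and deleting [D], the sets [C i] with [i \in s] are
   cycles of the minor, and [#|s|] is its corank. *)
Record minor_inv s C K D : Prop := MinorInv {
  minv_disjK : forall i, i \in s -> [disjoint C i & K];
  minv_disjD : forall i, i \in s -> [disjoint C i & D];
  minv_KD : [disjoint K & D];
  minv_cycle : forall i x, i \in s -> x \in C i -> exists I,
    [/\ I \in indep M, I \subset K :|: (C i :\ x) & x |: I \notin indep M];
  minv_span : exists B, [/\ B \in indep M, [disjoint B & D] & #|B| = rank M];
  minv_card : #|s| + #|D| = corank M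
}.

Variable le : rel T.

(** The point is a basis avoiding [e |: D]. An independent [I] inside [K :|: (C i :\ e)] with
    [e |: I] dependent avoids [D]; extending it by elements of a basis avoiding [D] can never bring
    in [e]. *)
Lemma minor_inv_out s C K D e i :
  selects le C s e i -> minor_inv s C K D -> minor_inv (s :\ i) C K (e |: D).
Proof.
move=> sel [dK dD KD cyc [B [hB BD cB]] card]; have [_ _ si Ci] := sel.
have eK : e \notin K by rewrite (disjointFr (dK i si)).
have eD : e \notin D by rewrite (disjointFr (dD i si)).
split.
- by move=> j /setD1P[_ /dK].
- move=> j /setD1P[/eqP ji sj]; rewrite disjoint_sym disjoints1U disjoint_sym dD //.
  by rewrite andbT; apply/negP => /(selects_uniq sel sj).
- by rewrite disjoint_sym disjoints1U eK disjoint_sym.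
- by move=> j x /setD1P[_]; apply: cyc.
- have [I [hI IC eI]] := cyc _ _ si Ci.
  have [|J [hJ IJ JIB cJ]] := indep_extend hI hB; first by rewrite cB rank_max.
  exists J; split; rewrite ?cJ ?cB //.
  rewrite disjoint_sym disjoints1U; apply/andP; split.
    apply: contra eI => eJ; apply: indepS hJ _.
    by rewrite subUset sub1set eJ.
  rewrite disjoint_sym; apply: disjointWl JIB _.
  rewrite disjoints_subset subUset -!disjoints_subset BD andbT.
  apply: disjointWl IC _; rewrite disjoints_subset subUset -!disjoints_subset KD.
  by apply: disjointWl (dD i si); apply: subsetDl.
- by rewrite cardsU1 eD -card (cardsD1 i s) si addnCA addnA.
Qed.

(** Moving [e] from [C i] to [K] does not shrink the sets [K :|: (C j :\ x)] for the remaining [x],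
    so the old witnesses [I] still serve. *)
Lemma minor_inv_in s C K D e i : selects le C s e i -> minor_inv s C K D ->
  minor_inv s (update C i (C i :\ e)) (e |: K) D.
Proof.
move=> sel [dK dD KD cyc span card]; have [_ _ si Ci] := sel.
have Csub j : update C i (C i :\ e) j \subset C j.
  by rewrite ffunE; case: eqP => [->|//]; apply: subsetDl.
split=> //.
- move=> j sj; rewrite disjoint_sym disjoints1U; apply/andP; split; last first.
    by rewrite disjoint_sym; apply: disjointWl (Csub j) (dK _ sj).
  rewrite ffunE; case: eqP => [_|ji]; first by rewrite !inE eqxx.
  by apply/negP => /(selects_uniq sel sj).
- by move=> j sj; apply: disjointWl (Csub j) (dD _ sj).
- by rewrite disjoints1U KD (disjointFr (dD _ si)).
- move=> j x sj Cjx; have [I [hI IC xI]] := cyc _ _ sj (subsetP (Csub j) _ Cjx).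
  exists I; split=> //; apply: subset_trans IC _.
  apply/subsetP => y; rewrite !in_setU !in_setD1 !in_set1 ffunE.
  case: (eqVneq j i) => [->|_]; last by case/orP=> ->; rewrite !orbT.
  by rewrite in_setD1; case: (eqVneq y e) => //= _; case/orP=> ->; rewrite ?orbT.
Qed.

Hypothesis le_lin : linear_order le.

(* Only dependence of the unique unions is used here, only cyclicity of the
   sets [C i] in [coparking_run]. *)
Lemma indep_run s C K0 I :
    (forall t, t \subset s -> t != set0 -> K0 :|: uunion C t \notin indep M) ->
    I \in indep M -> K0 \subset I ->
  exists a X K, [/\ run le s C a X K, K \subset I & [disjoint X & I]].
Proof.
move=> + hI; have [n] := ubnP (run_measure C s); elim: n s C K0 => // n IH s C K0.
rewrite ltnS => len dep K0I.
have [->|s0] := eqVneq s set0.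
  exists [ffun=> 0], set0, set0; split; [exact: RunStop|exact: sub0set|].
  by rewrite disjoints_subset sub0set.
have [|e [i sel]] := @selects_ex _ _ _ le_lin C s.
  (* An empty unique union would make [K0] dependent, although [K0 \subset I]. *)
  apply: contraNneq (dep _ (subxx _) s0) => ->.
  by rewrite setU0; apply: indepS hI K0I.
have [eI|eI] := boolP (e \in I).
  have [|t ts t0||a [X [K [r KI XI]]]] := IH s (update C i (C i :\ e)) (e |: K0).
  - exact: leq_trans (run_measure_in sel) len.
  (* The element leaving the unique union joins [K0], so the dependent set does not shrink. *)
  - rewrite (uunion_setD1 sel) //.
    apply: contra (dep t ts t0) => h; apply: indepS h _.
    by apply/subsetP => x; rewrite !in_setU in_setD1 in_set1; case: eqP.
  - by rewrite subUset sub1set eI.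
  by exists (update a i (a i).+1), X, (e |: K); split=> //;
    [exact: RunIn sel r | rewrite subUset sub1set eI].
have [||//|a [X [K [r KI XI]]]] := IH (s :\ i) C K0.
- exact: leq_trans (run_measure_out sel) len.
- by move=> t ts; apply: dep (subset_trans ts (subD1set s i)).
exists a, (e |: X), K; split=> //; first exact: RunOut sel r.
by rewrite disjoints1U eI.
Qed.

(** The coparking condition at [s] makes the unique union nonempty, and whether [a i] is zero
    decides the step. Once [s] is empty, [D] has [corank M] elements and misses a basis, which must
    then be its complement. *)
Lemma coparking_run s C K0 D a : minor_inv s C K0 D ->
    coparking_on C s a -> (forall i, i \notin s -> a i = 0) ->
  exists X K, run le s C a X K /\ ~: (X :|: D) \in bases M.
Proof.
have [n] := ubnP (run_measure C s).
elim: n s C K0 D a => // n IH s C K0 D a; rewrite ltnS => len inv ha supp.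
have [s0|s0] := eqVneq s set0.
  exists set0, set0; have -> : a = [ffun=> 0].
    by apply/ffunP => i; rewrite ffunE supp // s0 inE.
  rewrite s0 set0U; split; first exact: RunStop.
  have [_ _ _ _ [B [hB BD cB]] card] := inv.
  suff <- : B = ~: D by apply/basesP.
  apply/eqP; rewrite eqEcard -disjoints_subset BD cB cardsCs setCK -corankE -card s0.
  by rewrite cards0 add0n addKn leqnn.
have [|e [i sel]] := @selects_ex _ _ _ le_lin C s.
  have [i si] := ha s (subxx _) s0; apply: contraTneq => ->.
  by rewrite setI0 cards0 ltn0.
have [_ _ si _] := sel.
have [a0|ai] := posnP (a i).
  have [||j js|X [K [r hX]]] := IH _ _ _ _ a _ (minor_inv_out sel inv).
  - exact: leq_trans (run_measure_out sel) len.
  - by apply: coparking_onS ha; apply: subsetDl.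
  - by move: js; rewrite !inE negb_and negbK => /orP[/eqP->|/supp].
  exists (e |: X), K; split; first exact: RunOut sel r.
  by rewrite -setUA setUCA.
pose b := update a i (a i).-1.
have ab : a = update b i (b i).+1.
  by apply/ffunP => j; rewrite !ffunE eqxx; case: eqP => // ->; rewrite prednK.
have [||j js|X [K [r hX]]] := IH _ _ _ _ b _ (minor_inv_in sel inv).
- exact: leq_trans (run_measure_in sel) len.
- by apply/(coparking_on_in _ sel); rewrite -ab.
- by rewrite ffunE; case: eqP js => [->|_ /supp //]; rewrite si.
by exists X, (e |: K); split=> //; rewrite ab; apply: RunIn sel r.
Qed.

End Minor.
End Matroid.

(** * Interval partitions and the h-vector *)

Lemma sum_interval (R : comNzRingType) (T : finType) (u : R) (K B : {set T}) :
  K \subset B ->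
  (\sum_(I : {set T} | (K \subset I) && (I \subset B)) u ^+ #|B :\: I|
    = (1 + u) ^+ #|B :\: K|)%R.
Proof.
(* Expanding the product of [F x + G x] picks [F] on a subset [I] and [G] off it. [F] vanishes off
   [B] and [G] on [K], so only [I] between [K] and [B] survive. *)
move=> KB; pose F x : R := ((x \in B)%:R)%R.
pose G x : R := (if x \in K then 0 else if x \in B then u else 1)%R.
have <- : (\prod_x (F x + G x) = (1 + u) ^+ #|B :\: K|)%R.
  rewrite -prodr_const [RHS]big_mkcond /=; apply: eq_bigr => x _.
  rewrite /F /G inE; have := subsetP KB x.
  by case: (x \in K) => [->|_] //; last case: (x \in B); rewrite ?addr0 ?add0r.
rewrite bigA_distr big_mkcond /=; apply: eq_bigr => I _; case: ifP => [/andP[KI IB]|].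
  rewrite -prodr_const big_mkcond /=; apply: eq_bigr => x _; rewrite /F /G inE.
  have := subsetP KI x; have := subsetP IB x.
  by case: (x \in I) => [->|_] //; case: (x \in K) => [/(_ isT)|_] //; case: (x \in B).
move/negP/negP; rewrite negb_and => /orP[]/subsetPn[x].
  by move=> xK xI; rewrite (bigD1 x) //= (negPf xI) /G xK mul0r.
by move=> xI xB; rewrite (bigD1 x) //= xI /F (negPf xB) mul0r.
Qed.

Section HVector.
Variables (T : finType) (M : matroid T) (kap top : {set T} -> {set T}).
Hypothesis top_base : forall I, I \in indep M -> top I \in bases M.
Hypothesis topE : forall B I, B \in bases M ->
  (I \in indep M) && (top I == B) = (kap B \subset I) && (I \subset B).
Hypothesis kap_sub : forall B, B \in bases M -> kap B \subset B.

Lemma h_poly_intervals :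
  h_poly M = (\sum_(B in bases M) 'X^(rank M - #|kap B|))%R.
Proof.
rewrite /h_poly;
  transitivity (\sum_(I in indep M) ('X - 1 : {poly int}) ^+ (rank M - #|I|))%R.
  rewrite [RHS](partition_big (fun I : {set T} => inord #|I|
    : 'I_(rank M).+1) xpredT) //=.
  apply: eq_bigr => i _; rewrite mul_polyC.
  rewrite (eq_bigr (fun _ => ('X - 1 : {poly int}) ^+ (rank M - i))%R); last first.
    by move=> I /andP[hI /eqP <-]; rewrite inordK // ltnS rank_max.
  rewrite sumr_const -natz scaler_nat; congr (_ *+ _)%R.
  apply: eq_card => I; rewrite inE [RHS]unfold_in;
    case: (boolP (I \in indep M)) => //= hI.
  by rewrite -val_eqE /= inordK // ltnS rank_max.
rewrite (partition_big top (fun B => B \in bases M)) //=; apply: eq_bigr => B hB.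
have [_ cB] := basesP _ _ hB.
rewrite (eq_bigl _ _ (fun I => topE I hB)).
(* With [u = 'X - 1], the sum over one interval collapses to a single power of ['X]. *)
have -> : ('X^(rank M - #|kap B|) = (1 + ('X - 1)) ^+ #|B :\: kap B| :> {poly int})%R.
  by rewrite addrC subrK cardsDS ?kap_sub // cB.
rewrite -sum_interval ?kap_sub //.
by apply: eq_bigr => I /andP[_ IB]; rewrite cardsDS // cB.
Qed.

Lemma h_vector_intervals k :
  ((h_vector M)`_k)%R = (#|[set B in bases M | #|kap B| == k]|%:Z)%R.
Proof.
have kapr B : B \in bases M -> #|kap B| <= rank M.
  by move=> hB; have [_ <-] := basesP _ _ hB; rewrite subset_leq_card ?kap_sub.
(* Beyond the rank, the left side is the default [0] of [nth], and no [kap B] is that large. *)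
have [kr|rk] := ltnP k (rank M).+1; last first.
  rewrite nth_default ?size_mkseq // (_ : [set _ in _ | _] = set0) ?cards0 //.
  apply/setP => B; rewrite !in_set0 in_set; apply/andP => -[/kapr h /eqP Ek].
  by rewrite Ek leqNgt rk in h.
rewrite nth_mkseq // h_poly_intervals coef_sum -sum1dep_card -natz natr_sum.
rewrite big_mkcondr /=; apply: eq_bigr => B hB.
(* Truncated subtraction from the rank can be cancelled because [k] and [#|kap B|] are both at most
   the rank. *)
rewrite coefXn eq_sym eqn_sub2lE ?kapr //.
by case: eqP.
Qed.

End HVector.

(** * The bijection and purity for a cycle system *)

Section CycleSystem.
Variables (T : finType) (M : matroid T) (C : {ffun 'I_(corank M) -> {set T}}).
Hypothesis hC : cycle_system C.

Lemma cycle_system_minor_inv : minor_inv M [set: 'I_(corank M)] C set0 set0.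
Proof.
have disj0 (A : {set T}) : [disjoint A & set0].
  by rewrite disjoints_subset setC0 subsetT.
split=> //; last by rewrite cardsT card_ord cards0 addn0.
  by move=> i x _ Cx; rewrite set0U; apply: cycle_dependence Cx; case: hC.
by have [B hB cB] := rank_ex M; exists B.
Qed.

Variable le : rel T.
Hypothesis le_lin : linear_order le.

Lemma coparking_run_bases a : coparking C a ->
  exists B K, B \in bases M /\ run le [set: 'I_(corank M)] C a (~: B) K.
Proof.
move=> /coparking_onT ha.
have [|X [K [r hX]]] := coparking_run le_lin cycle_system_minor_inv ha.
  by move=> i; rewrite inE.
by exists (~: X), K; rewrite setCK -[X]setU0 {2}setU0.
Qed.

(** [indep_run] gives a transcript fitting [I], but not that the complement of [X] is a basis. Its
    [a] is coparking, so [coparking_run_bases] gives one ending in a basis, and [run_inj] identifies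
    the two. *)
Lemma indep_run_bases I : I \in indep M ->
  exists a B K, [/\ run le [set: 'I_(corank M)] C a (~: B) K,
                     K \subset I, I \subset B & B \in bases M].
Proof.
move=> hI; have [t _ t0||a [X [K [r KI XI]]]] :=
  @indep_run _ M _ _ le_lin [set: 'I_(corank M)] C set0 I _ hI.
- by rewrite set0U; case: hC => _; apply.
- exact: sub0set.
have [B [K' [hB r']]] := coparking_run_bases ((coparking_onT C a).2 (run_coparking r)).
have [XE _] := run_inj le_lin r r'.
exists a, B, K; rewrite -XE; split=> //.
by rewrite -[B]setCK -XE -disjoints_subset disjoint_sym.
Qed.

Lemma transcript_ex :
  exists (phi : {set T} -> {ffun 'I_(corank M) -> nat}) (top kap : {set T} -> {set T}),
  forall I, I \in indep M ->
    [/\ run le [set: 'I_(corank M)] C (phi I) (~: top I) (kap I),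
        kap I \subset I, I \subset top I & top I \in bases M].
Proof.
have [I|f hf] := @fin_all_exists {set T}
    (fun=> {ffun 'I_(corank M) -> nat} * {set T} * {set T})%type
    (fun I p => I \in indep M ->
       [/\ run le [set: 'I_(corank M)] C p.1.1 (~: p.1.2) p.2,
           p.2 \subset I, I \subset p.1.2 & p.1.2 \in bases M]).
  (* Finite choice needs a value at every set; at dependent sets it is arbitrary. *)
  have [hI|nI] := boolP (I \in indep M); last by exists ([ffun=> 0], set0, set0).
  by have [a [B [K h]]] := indep_run_bases hI; exists (a, B, K).
by exists (fun I => (f I).1.1), (fun I => (f I).1.2), (fun I => (f I).2).
Qed.

Section Transcript.
Variables (phi : {set T} -> {ffun 'I_(corank M) -> nat}) (top kap : {set T} -> {set T}).
Hypothesis phiP : forall I, I \in indep M ->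
    [/\ run le [set: 'I_(corank M)] C (phi I) (~: top I) (kap I),
        kap I \subset I, I \subset top I & top I \in bases M].

Lemma transcript_base B : B \in bases M ->
  run le [set: 'I_(corank M)] C (phi B) (~: B) (kap B) /\ kap B \subset B.
Proof.
move=> /basesP[hB cB]; have [r KB Btop /basesP[_ ctop]] := phiP hB.
have E : top B = B by apply/esym/eqP; rewrite eqEcard Btop cB ctop leqnn.
by rewrite E in r.
Qed.

Lemma transcript_unique I a B K : I \in indep M ->
    run le [set: 'I_(corank M)] C a (~: B) K -> K \subset I -> I \subset B ->
  [/\ phi I = a, top I = B & kap I = K].
Proof.
move=> hI r KI IB; have [r' K'I Itop _] := phiP hI.
have disjC (A : {set T}) : I \subset A -> [disjoint ~: A & I].
  by rewrite disjoint_sym disjoints_subset setCK.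
by have [-> /setC_inj-> ->] := run_fun le_lin r KI (disjC _ IB) r' K'I (disjC _ Itop).
Qed.

(** If [top I = B], the transcript of [I] also fits [B], since [kap I \subset I] and [I \subset B],
    so it is the transcript of [B]. Conversely, that of [B] fits every [I] in between. *)
Lemma transcript_interval B I : B \in bases M ->
  (I \in indep M) && (top I == B) = (kap B \subset I) && (I \subset B).
Proof.
move=> hB; have [r KB] := transcript_base hB; have [iB _] := basesP _ _ hB.
apply/andP/andP => [[hI /eqP topI]|[KI IB]].
  have [r' K'I Itop _] := phiP hI; rewrite topI in r' Itop.
  by have [_ _ ->] := transcript_unique iB r' (subset_trans K'I Itop) (subxx _).
have hI : I \in indep M by apply: indepS iB IB.
by split=> //; have [_ -> _] := transcript_unique hI r KI IB.
Qed.

Lemma transcript_coparking B : B \in bases M -> coparking C (phi B).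
Proof. by move=> /transcript_base[/run_coparking/coparking_onT]. Qed.

Lemma transcript_inj : {in bases M &, injective phi}.
Proof.
move=> B B' /transcript_base[r _] /transcript_base[r' _] EB; rewrite EB in r.
by have [/setC_inj] := run_inj le_lin r r'.
Qed.

Lemma transcript_surj a : coparking C a -> exists2 B, B \in bases M & phi B = a.
Proof.
move=> /coparking_run_bases[B [K [hB r]]]; exists B => //.
have [iB _] := basesP _ _ hB; have := run_disj r.
rewrite disjoint_sym disjoints_subset setCK => KB.
by have [] := transcript_unique iB r KB (subxx _).
Qed.

Lemma procedures_bijective : exists psi,
  [/\ forall B, B \in bases M -> basis_to_coparking le C B (phi B),
      forall a, coparking C a -> coparking_to_basis le C a (psi a),
      forall B, B \in bases M -> coparking C (phi B) /\ psi (phi B) = B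
    & forall a, coparking C a -> psi a \in bases M /\ phi (psi a) = a].
Proof.
(* The inverse is found by search; [set0] is the default only when [a] is not coparking. *)
pose psi a := odflt set0 [pick B in bases M | phi B == a].
have psiP a : coparking C a -> psi a \in bases M /\ phi (psi a) = a.
  move=> /transcript_surj[B hB Ea]; rewrite /psi;
    case: pickP => [B' /andP[hB' /eqP]//|/(_ B)].
  by rewrite /= hB Ea eqxx.
exists psi; split=> [B hB|a /psiP[hB Ea]|B hB|]; last exact: psiP.
- have [r KB] := transcript_base hB.
  have := run_basis_to_coparking le_lin [ffun=> 0] r KB.
  rewrite disjoints_subset subxx => /(_ isT).
  suff -> : [ffun i => [ffun=> 0] i + phi B i] = phi B by [].
  by apply/ffunP => i; rewrite !ffunE.
- have [r _] := transcript_base hB; rewrite Ea in r.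
  have := run_coparking_to_basis le_lin (b := [ffun i => ((a i)%:Z)%R]) [set: T] r.
  rewrite setTD setCK; apply=> i _; exact: ffunE.
- have cB := transcript_coparking hB; split=> //.
  by have [hB' /transcript_inj->] := psiP _ cB.
Qed.

Lemma h_vector_pure_O : pure_O_sequence (h_vector M).
Proof.
(* Taking the coparking functions as the image of the bases makes their finiteness immediate. *)
exists (corank M), [fset phi B | B in bases M]%fset.
have inP v : v \in [fset phi B | B in bases M]%fset <-> coparking C v.
  split=> [/imfsetP[B /= hB ->]|/transcript_surj[B hB <-]].
    exact: transcript_coparking.
  by apply/imfsetP; exists B.
split.
- have [B hB cB] := rank_ex M; apply/fset0Pn; exists (phi B).
  by apply/inP/transcript_coparking/basesP.
- move=> u v /inP/coparking_onT hv uv; apply/inP/coparking_onT.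
  exact: coparking_on_le hv.
- have max_weight v : v \in [fset phi B | B in bases M]%fset /\
      (forall w, w \in [fset phi B | B in bases M]%fset ->
         (forall j, v j <= w j) -> w = v) ->
      \sum_j v j = #|\bigcup_(i in [set: 'I_(corank M)]) C i| - #|[set: 'I_(corank M)]|.
    case=> /inP/coparking_onT hv maxv.
    (* A maximal [v] equals its own extension, whose coordinate sum does not depend on [v]. *)
    have [w [/coparking_onT/inP hw vw <-]] := coparking_on_extend hv.
    rewrite (maxv w hw vw) addnK; apply: eq_bigl => j; by rewrite inE.
  by move=> u v /max_weight-> /max_weight->.
- move=> i; rewrite (@h_vector_intervals _ M kap top) => [|I hI|B I|B hB].
  + rewrite (_ : [fset v in _ | _]%fset =
      [fset phi B | B in [set B in bases M | #|kap B| == i]]%fset); last first.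
      apply/fsetP => v; rewrite !inE /=; apply/andP/imfsetP.
        move=> [/imfsetP[B /= hB ->] Ei]; exists B => //=.
        by have [r _] := transcript_base hB; rewrite inE hB (run_cardK r).
      move=> [B /=]; rewrite inE => /andP[hB Ei ->].
      have [r _] := transcript_base hB; rewrite -(run_cardK r); split=> //.
      by apply/imfsetP; exists B.
    rewrite card_in_imfset /=; first by rewrite cardE.
    by move=> B B' /setIdP[hB _] /setIdP[hB' _]; apply: transcript_inj.
  + by have [] := phiP hI.
  + exact: transcript_interval.
  + by have [] := transcript_base hB.
Qed.

End Transcript.
End CycleSystem.

Theorem mainTheorem3 (T : finType) (M : matroid T)
    (C : {ffun 'I_(corank M) -> {set T}}) (hC : cycle_system C) :
  (forall le : rel T, linear_order le ->
     exists (phi : {set T} -> {ffun 'I_(corank M) -> nat})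
            (psi : {ffun 'I_(corank M) -> nat} -> {set T}),
       [/\ forall B, B \in bases M -> basis_to_coparking le C B (phi B),
           forall a, coparking C a -> coparking_to_basis le C a (psi a),
           forall B, B \in bases M -> coparking C (phi B) /\ psi (phi B) = B
         & forall a, coparking C a -> psi a \in bases M /\ phi (psi a) = a]) /\
  pure_O_sequence (h_vector M).
Proof.
split=> [le le_lin|].
  have [phi [top [kap phiP]]] := transcript_ex hC le_lin.
  by exists phi; apply: procedures_bijective phiP.
(* The h-vector does not depend on an order, so any linear order serves. *)
pose le (x y : T) := enum_rank x <= enum_rank y.
have le_lin : linear_order le.
  split=> [x y|x y|y x z]; [exact: leq_total| |exact: leq_trans].
  by rewrite /le -eqn_leq => /eqP/val_inj/enum_rank_inj.
have [phi [top [kap phiP]]] := transcript_ex hC le_lin.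
exact: h_vector_pure_O phiP.
Qed.
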